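(* Let $(X,\mathcal{F})$ be a set system. Then the following hold. 1. Both $(X,\mathcal{F})$ and its dual system $(Y_{\mathcal{F}},\mathcal{F}^* )$ are well-graded if and only if $(X,\mathcal{F})$ is either a full-chain system or an upward-starlike system or a downward-starlike system. Moreover, every $(X,\mathcal{F})$ such that both it and its dual system are well-graded has additionality $1$. 2. Both $(X,\mathcal{F})$ and its essential dual $(Y_{\mathcal{F}},\mathcal{F}^*_{ess})$ are well-graded if and only if $(X,\mathcal{F})$ is a full-chain system. Moreover, every $(X,\mathcal{F})$ such that both it and its essential dual are well-graded has additionality $1$.
   Context: A set system $(X,\mathcal{F})$ is a finite set $X$ (the domain) together with a nonempty family $\mathcal{F}$ of distinct subsets of $X$. Its one-inclusion graph $G_{\mathcal{F}}$ is the edge-labelled directed graph with one vertex $v_A$ for each $A\in\mathcal{F}$ and a directed edge from $v_A$ to $v_B$ with label $b$ whenever $B=A\cup\{b\}$ for some $b\in X\setminus A$. For directed graphs, connectedness, being a tree, distances $d_G$ and degrees refer to the underlying undirected graph (the distance is infinite if there is no path). The system is well-graded if $|A\triangle B|=d_{G_{\mathcal{F}}}(v_A,v_B)$ for all $A,B\in\mathcal{F}$. This condition is applied verbatim to dual and essential dual families, also if such a family happens to be empty (then it is vacuously satisfied). An element $x\in X$ is essential if there are $A,B\in\mathcal{F}$ with $x\in A$, $x\notin B$; $ess_{\mathcal{F}}(X)$ is the set of essential elements. The additionality of $(X,\mathcal{F})$ is $|\mathcal{F}|-|ess_{\mathcal{F}}(X)|$. Dual system: $Y_{\mathcal{F}}=\{y_A:A\in\mathcal{F}\}$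 with distinct symbols $y_A$; for $x\in X$, $\mathcal{A}_x=\{y_A:A\in\mathcal{F},\ x\in A\}$; $\mathcal{F}^*=\{\mathcal{A}_x:x\in X\}$ (as a set, without multiplicities). The dual system is $(Y_{\mathcal{F}},\mathcal{F}^* )$. The essential dual is $(Y_{\mathcal{F}},\mathcal{F}^*_{ess})$ with $\mathcal{F}^*_{ess}=\{\mathcal{A}_x:x\in ess_{\mathcal{F}}(X)\}$. $(X,\mathcal{F})$ is a full-chain system if the members of $\mathcal{F}$ can be ordered as $A_1\subseteq A_2\subseteq\dots\subseteq A_n$ with $|A_i\setminus A_{i-1}|=1$ for $2\le i\le n$ (length $n\geq 1$ allowed; the domain may contain elements belonging to every or to no member). In a connected directed graph $G$, a vertex $v$ is a source if every edge, directed from $w$ to $z$, satisfies $d_G(w,v)<d_G(z,v)$; it is a sink if every edge, directed from $w$ to $z$, satisfies $d_G(w,v)>d_G(z,v)$. An edge-labelled directed tree is starlike if all its edge labels are distinct and it has a distinguished vertex $v_0$ (the centre) of degree at least $2$ which is a source or a sink, while all other vertices have degree at most $2$. $(X,\mathcal{F})$ is upward-starlike if $G_{\mathcal{F}}$ is starlike, $\emptyset\in\mathcal{F}$, $v_\emptyset$ is the centre and a source, and some element of $X$ belongs to no member of $\mathcal{F}$. It is downward-starlike if $G_{\mathcal{F}}$ is starlike, $X\in\mathcal{F}$, $v_X$ is the centre and a sink, and some element of $X$ belongs to every member of $\mathcal{F}$. *)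

(* Defs.v *)
From mathcomp Require Import all_boot all_order all_algebra.
Set Implicit Arguments.
Unset Strict Implicit.
Unset Printing Implicit Defensive.

(* An edge-labelled directed graph on V with labels in L is its set of arcs;
   (u, v, b) is an arc from u to v labelled b. *)
Section LabelledDigraph.
Variables (V L : finType).
Implicit Types (G : {set V * V * L}) (u v w z : V).

(* Adjacency in the underlying undirected graph; degrees, paths, distances,
   connectedness and cycles all refer to it.  Parallel and antiparallel arcs
   would be identified, but a one-inclusion graph has none. *)
Definition adj G : rel V :=
  fun u v => [exists b, ((u, v, b) \in G) || ((v, u, b) \in G)].

Definition degree G v : nat := #|adj G v|.

Definition walk G u v (n : nat) : bool :=
  [exists p : n.-tuple V, path (adj G) u p && (last u p == v)].

Lemma connect_walk G u v : connect (adj G) u v -> exists n, walk G u v n.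
Proof.
case/connectP=> p pth ->; exists (size p); apply/existsP.
by exists (in_tuple p); rewrite /= pth eqxx.
Qed.

(* None stands for an infinite distance. *)
Definition dist G u v : option nat :=
  match boolP (connect (adj G) u v) with
  | AltTrue cuv => Some (ex_minn (connect_walk cuv))
  | AltFalse _ => None
  end.

Definition dist_lt (d e : option nat) : bool :=
  match d, e with
  | Some m, Some n => m < n
  | Some _, None => true
  | None, _ => false
  end.

Definition connected G : Prop := forall u v, connect (adj G) u v.

(* u, v is a ucycle of length 2 as soon as u and v are adjacent. *)
Definition acyclic G : Prop :=
  forall c : seq V, 2 < size c -> ~ ucycle (adj G) c.

Definition is_tree G : Prop := connected G /\ acyclic G.

Definition is_source G v : Prop :=
  forall w z b, (w, z, b) \in G -> dist_lt (dist G w v) (dist G z v).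

Definition is_sink G v : Prop :=
  forall w z b, (w, z, b) \in G -> dist_lt (dist G z v) (dist G w v).

Definition starlike_centre G v0 : Prop :=
  [/\ is_tree G,
      {in G &, injective (fun e : V * V * L => e.2)},
      2 <= degree G v0,
      is_source G v0 \/ is_sink G v0
    & forall v, v != v0 -> degree G v <= 2].

End LabelledDigraph.

(* The domain of a set system is the whole finite type X.  Families are not
   required to be nonempty here, since dual families may be empty. *)
Section SetSystem.
Variable X : finType.
Implicit Types (F : {set {set X}}).

(* The members of F as a type: the vertices v_A of the one-inclusion graph,
   and also the symbols y_A that form the domain of the dual system. *)
Definition member F : finType := {A : {set X} | A \in F}.

Definition one_inclusion_graph F : {set member F * member F * X} :=
  [set e : member F * member F * X |
     (e.2 \notin val e.1.1) && (val e.1.2 == e.2 |: val e.1.1)].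

Definition symdiff (A B : {set X}) : {set X} := (A :\: B) :|: (B :\: A).

Definition well_graded F : Prop :=
  forall A B : member F,
    dist (one_inclusion_graph F) A B = Some #|symdiff (val A) (val B)|.

Definition ess F : {set X} :=
  [set x | [exists A in F, x \in A] && [exists B in F, x \notin B]].

(* An integer, since it can be negative: F = {set0; setT} with #|X| > 2. *)
Definition additionality F : int := (#|F|%:Z - #|ess F|%:Z)%R.

Definition dual_set F (x : X) : {set member F} := [set y : member F | x \in val y].

Definition dual F : {set {set member F}} := [set dual_set F x | x : X].

Definition ess_dual F : {set {set member F}} := [set dual_set F x | x in ess F].

Definition full_chain F : Prop :=
  exists2 s : seq {set X}, perm_eq s (enum F) &
    sorted (fun A B : {set X} => (A \subset B) && (#|B :\: A| == 1)) s.

Definition upward_starlike F : Prop :=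
  (exists v : member F,
     [/\ val v = set0, starlike_centre (one_inclusion_graph F) v
       & is_source (one_inclusion_graph F) v])
  /\ (exists x : X, forall A, A \in F -> x \notin A).

Definition downward_starlike F : Prop :=
  (exists v : member F,
     [/\ val v = setT, starlike_centre (one_inclusion_graph F) v
       & is_sink (one_inclusion_graph F) v])
  /\ (exists x : X, forall A, A \in F -> x \in A).

End SetSystem.

(* Main.v *)
Require Import Defs.
From mathcomp Require Import all_boot all_order all_algebra.
From mathcomp Require Import zify.

Set Implicit Arguments.
Unset Strict Implicit.
Unset Printing Implicit Defensive.

(** A family is well-graded exactly when it is [stepwise]: from any member, toggling one suitable
    element gives a member one step closer to any prescribed other member. Fix a member [R] and let
    every other member choose a step towards [R]; the labels chosen are precisely the essential
    elements ([ess_step_labels]). So a nonempty well-graded family has at least one more member than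
    essential elements, and if the excess is exactly one, no label occurs on two edges
    ([unique_labels_of_card]).

    Apply this to [F] and to the family of dual sets of the elements of [D], where [D] is the whole
    domain or [ess F]. An inessential element has dual set [set0] (void) or [setT] (full), and a
    symbol inessential in the dual comes from a member that avoids [D] (bottom) or contains it
    (top). This bounds the size of each family by the number of essential elements of the other plus
    at most two. Bottom excludes full and top excludes void, so all four inequalities are tight
    ([dual_step_counting]): the additionality is 1, labels are unique in both families, and there is
    a bottom or a full, and a top or a void.

    Bottom and top: unique labels between a least and a greatest member force a chain. Void and
    full: the dual family is such a chain, hence so is [F]. Bottom and void, with [D] the whole
    domain: the graph is rooted at the empty set, and the dual condition leaves each nonempty member
    at most one upward edge, so the family is a chain or an upward star. Top and full is the
    complement of this case. If [D] is [ess F], there is neither a void nor a full element, so only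
    chains remain. Conversely, in a chain or an upward star each nonempty dual set consists of all
    members above a least one, and deleting that least one gives a dual set whenever a step requires
    it ([dual_step_of_least]). *)

Section Distance.
Variables (V L : finType) (G : {set V * V * L}).

(** * Walks and distances *)

Lemma walkP u v n :
  reflect (exists p, [/\ size p = n, path (adj G) u p & last u p = v]) (walk G u v n).
Proof.
apply: (iffP existsP) => [[p /andP[pth /eqP lst]]|[p [sz pth lst]]].
  by exists p; rewrite size_tuple.
have sz' : size p == n by apply/eqP.
by exists (Tuple sz'); rewrite /= pth lst eqxx.
Qed.

Lemma dist_SomeP u v n :
  dist G u v = Some n <-> walk G u v n /\ (forall m, walk G u v m -> n <= m).
Proof.
rewrite /dist; case: {-}_ / boolP => [cuv|ncuv].
  case: ex_minnP => k wk mink; split=> [[<-]//|[wn minn]].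
  by congr Some; apply/eqP; rewrite eqn_leq mink // minn.
split=> // -[/walkP[p [_ pth lst]] _]; case/negP: ncuv.
by apply/connectP; exists p.
Qed.

Lemma dist_Some_connect u v n : dist G u v = Some n -> connect (adj G) u v.
Proof.
by case/dist_SomeP => /walkP[p [_ pth lst]] _; apply/connectP; exists p.
Qed.

End Distance.

(** * Single-element steps and well-gradedness *)

Section Families.
Variable X : finType.
Implicit Types (F : {set {set X}}) (A B C M P : {set X}) (x y z : X).

(** Crosses an edge labelled [x] of the one-inclusion graph in either direction. *)
Definition toggle x A : {set X} := symdiff A [set x].

(** The local form of well-gradedness: the first edge of a geodesic from [A] to [B]. *)
Definition stepwise F : Prop := forall A B, A \in F -> B \in F -> A != B ->
  exists2 x, x \in symdiff A B & toggle x A \in F.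

Lemma in_symdiff A B z : (z \in symdiff A B) = (z \in A) (+) (z \in B).
Proof. by rewrite !inE; case: (z \in A); case: (z \in B). Qed.

Lemma in_toggle x A z : (z \in toggle x A) = (z \in A) (+) (z == x).
Proof. by rewrite in_symdiff inE. Qed.

Lemma symdiffxx A : symdiff A A = set0.
Proof. by apply/setP => z; rewrite in_symdiff addbb inE. Qed.

Lemma symdiff_eq0 A B : (symdiff A B == set0) = (A == B).
Proof.
apply/eqP/eqP => [/setP AB|->]; last exact: symdiffxx.
by apply/setP => z; move: (AB z); rewrite in_symdiff inE; do 2!case: (_ \in _).
Qed.

Lemma toggleK x A : toggle x (toggle x A) = A.
Proof. by apply/setP => z; rewrite !in_toggle -addbA addbb addbF. Qed.

Lemma toggle_notin x A : x \notin A -> toggle x A = x |: A.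
Proof.
move=> xA; apply/setP => z; rewrite in_toggle !inE.
by case: eqP => [->|_]; rewrite ?(negPf xA) ?addbF.
Qed.

Lemma toggle_in x A : x \in A -> toggle x A = A :\ x.
Proof.
move=> xA; apply/setP => z; rewrite in_toggle !inE.
by case: eqP => [->|_]; rewrite ?xA ?addbF.
Qed.

Lemma symdiff_toggle x A B : symdiff (toggle x A) B = toggle x (symdiff A B).
Proof.
by apply/setP => z; rewrite !(in_symdiff, in_toggle) -!addbA (addbC (z \in B)).
Qed.

Lemma card_toggle_in x A : x \in A -> #|toggle x A| = #|A|.-1.
Proof. by move=> xA; rewrite toggle_in // (cardsD1 x A) xA. Qed.

Lemma card_toggle_le x A : #|A| <= #|toggle x A|.+1.
Proof.
case: (boolP (x \in A)) => xA.
  by rewrite (card_toggle_in xA); lia.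
by rewrite toggle_notin // cardsU1 xA; lia.
Qed.

Lemma one_inclusion_adj F (u v : member F) :
  adj (one_inclusion_graph F) u v = [exists x, val v == toggle x (val u)].
Proof.
apply: eq_existsb => x; rewrite !inE /=.
apply/orP/eqP => [[/andP[xu /eqP->]|/andP[xv /eqP->]]|->].
- by rewrite toggle_notin.
- by rewrite -(toggle_notin xv) toggleK.
- case: (boolP (x \in val u)) => xu; [right|left].
    rewrite in_toggle xu eqxx /= toggle_in //.
    by rewrite setD1K.
  by rewrite toggle_notin /=.
Qed.

Lemma symdiff_walk F (u v : member F) n :
  walk (one_inclusion_graph F) u v n -> #|symdiff (val u) (val v)| <= n.
Proof.
case/walkP => p [<- + <-]; elim: p u => [|w p IH] u /=; first by rewrite symdiffxx cards0.
case/andP; rewrite one_inclusion_adj => /existsP[x /eqP uw] /IH {IH}.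
rewrite uw symdiff_toggle => le.
by apply: leq_trans (card_toggle_le x _) _.
Qed.

(** Forwards, the first edge of a shortest walk is a step. Backwards, each step shrinks the
    symmetric difference by one, so iterating steps gives a walk of the required length, and
    [symdiff_walk] excludes shorter ones. *)
Lemma well_gradedP F : well_graded F <-> stepwise F.
Proof.
split=> [wg A B AF BF AB | st u v].
  have /dist_SomeP[/walkP[p [sz pth lst]] _] := wg (exist _ A AF) (exist _ B BF).
  rewrite /= in sz lst; case: p => [|c p] /= in sz pth lst.
    by case/eqP: AB; case: lst.
  case/andP: pth; rewrite one_inclusion_adj => /existsP[x /eqP /= cE] pth.
  have /dist_SomeP[_ /(_ (size p))] := wg c (exist _ B BF).
  have -> : walk (one_inclusion_graph F) c (exist _ B BF) (size p) by apply/walkP; exists p.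
  move=> /(_ isT) /= le; exists x; last by rewrite -cE (valP c).
  (* Toggling an element outside the symmetric difference would enlarge it, while the rest of the
     walk is too short for that. *)
  apply/negPn/negP => xAB; move: le; rewrite cE symdiff_toggle toggle_notin // cardsU1 xAB.
  by lia.
apply/dist_SomeP; split; last by move=> m; apply: symdiff_walk.
move: {2}#|_| (leqnn #|symdiff (val u) (val v)|) => n.
elim: n u => [|n IH] u.
  rewrite leqn0 cards_eq0 symdiff_eq0 => /eqP/val_inj ->.
  by rewrite symdiffxx cards0; apply/walkP; exists [::].
have [/val_inj->|uv] := eqVneq (val u) (val v).
  by rewrite symdiffxx cards0 => _; apply/walkP; exists [::].
case: (st _ _ (valP u) (valP v) uv) => x xuv cF le.
have := IH (exist _ (toggle x (val u)) cF); rewrite /= symdiff_toggle card_toggle_in //.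
have pos : 0 < #|symdiff (val u) (val v)| by apply/card_gt0P; exists x.
case/(_ _)/walkP => [|p [sz pth lst]]; first by rewrite -ltnS prednK.
apply/walkP; exists (exist _ (toggle x (val u)) cF :: p); split=> //=; first by rewrite sz prednK.
by rewrite pth one_inclusion_adj andbT; apply/existsP; exists x.
Qed.

(** * Edge labels and essential elements *)

Definition unique_labels F : Prop := forall x A C,
  A \in F -> C \in F -> toggle x A \in F -> toggle x C \in F ->
  x \notin A -> x \notin C -> A = C.

Lemma essP F x : reflect (exists A B, [/\ A \in F, B \in F, x \in A & x \notin B])
  (x \in ess F).
Proof.
rewrite inE; apply: (iffP andP) => [[/exists_inP[A AF xA] /exists_inP[B BF xB]]|].
  by exists A, B.
by case=> A [B [AF BF xA xB]]; split; apply/exists_inP; [exists A|exists B].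
Qed.

Lemma in_ess F A B x : A \in F -> B \in F -> x \in symdiff A B -> x \in ess F.
Proof.
rewrite in_symdiff => AF BF; case: (boolP (x \in A)) => xA /= xB; apply/essP.
  by exists A, B.
by exists B, A.
Qed.

                                                                             
                                          
(** An essential [x] separates some member from [R]. At such a member nearest to [R] the chosen step
    must toggle [x], since otherwise it would lead to a nearer member still separated by [x]. *)
Lemma ess_step_labels F R (f : {set X} -> X) : R \in F ->
  (forall A, A \in F -> A != R -> f A \in symdiff A R /\ toggle (f A) A \in F) ->
  ess F = f @: (F :\ R).
Proof.
move=> RF fP; apply/setP => x; apply/idP/imsetP => [|[A]]; last first.
  case/setD1P => AR AF ->; case: (fP _ AF AR) => + _.
  exact: in_ess.
case/essP => A [B [AF BF xA xB]].
have [C0 /andP[C0F xC0]] : exists C, (C \in F) && (x \in symdiff C R).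
  case: (boolP (x \in R)) => xR; [exists B|exists A]; rewrite in_symdiff.
    by rewrite BF xR (negPf xB).
  by rewrite AF xA.
have PC0 : (C0 \in F) && (x \in symdiff C0 R) by rewrite C0F.
case: (@arg_minnP _ C0 (fun C => (C \in F) && (x \in symdiff C R)) (fun C => #|symdiff C R|) PC0) => C /andP[CF xC] minC.
have CR : C != R by rewrite -symdiff_eq0; apply/set0Pn; exists x.
case: (fP _ CF CR) => fC tF; exists C; first by rewrite !inE CR.
apply/eqP/negPn/negP => xf.
have := minC (toggle (f C) C); rewrite tF symdiff_toggle in_toggle xC (negPf xf) /=.
move=> /(_ isT); rewrite card_toggle_in //.
have : 0 < #|symdiff C R| by apply/card_gt0P; exists x.
by lia.
Qed.

Definition step_choice F R A : X -> X := fun x0 =>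
  odflt x0 [pick x in symdiff A R | toggle x A \in F].

Lemma step_choiceP F R A x0 : stepwise F -> R \in F -> A \in F -> A != R ->
  step_choice F R A x0 \in symdiff A R /\ toggle (step_choice F R A x0) A \in F.
Proof.
move=> st RF AF AR; rewrite /step_choice; case: pickP => [x /andP[] //|no].
by case: (st _ _ AF RF AR) => x xAR tF; move: (no x); rewrite xAR tF.
Qed.

Lemma card_ess_lt F : F != set0 -> stepwise F -> #|ess F| < #|F|.
Proof.
case/set0Pn => R RF st.
(* A nonempty [ess F] supplies the default element that [step_choice] takes. *)
case: (set_0Vmem (ess F)) => [->|[x0 _]].
  by rewrite cards0; apply/card_gt0P; exists R.
rewrite (@ess_step_labels _ R (fun A => step_choice F R A x0)) //.
  by rewrite (cardsD1 R F) RF ltnS leq_imset_card.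
by move=> A AF AR; apply: step_choiceP.
Qed.

(** When the count is tight, every choice of steps towards a root is injective. With [A] as root,
    the upper ends of two edges labelled [x] can both step by [x], so they coincide. *)
Lemma unique_labels_of_card F : stepwise F -> #|F| <= #|ess F|.+1 -> unique_labels F.
Proof.
move=> st leF x A C AF CF xAF xCF xA xC.
(* The choice is imposed only at [toggle x C]; at [toggle x A] the step towards [A] is forced to be
   [x]. *)
pose f B := if B == toggle x C then x else step_choice F A B x.
have fP B : B \in F -> B != A -> f B \in symdiff B A /\ toggle (f B) B \in F.
  move=> BF BA; rewrite /f; case: eqP => [->|_]; last exact: step_choiceP.
  by rewrite toggleK in_symdiff in_toggle (negPf xC) (negPf xA) eqxx.
have tA : toggle x A != A.
  by apply/eqP => /setP/(_ x); rewrite in_toggle eqxx (negPf xA).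
have tC : toggle x C != A.
  by apply: (contraNneq _ xA) => <-; rewrite in_toggle eqxx (negPf xC).
have fA : f (toggle x A) = x.
  rewrite /f; case: eqP => // _; have [] := step_choiceP x st AF xAF tA.
  by rewrite symdiff_toggle in_toggle symdiffxx inE /= => /eqP.
have fC : f (toggle x C) = x by rewrite /f eqxx.
have inj : {in F :\ A &, injective f}.
  apply/imset_injP; rewrite eqn_leq leq_imset_card /= -(ess_step_labels AF fP).
  by move: leF; rewrite (cardsD1 A F) AF ltnS.
rewrite -(toggleK x A) -(toggleK x C); congr toggle.
by apply: inj; rewrite ?inE ?tA ?tC // fA fC.
Qed.

(** Steps from [A] towards a superset [B] only add elements of [B], and one of them must add [x]. *)
Lemma edge_between F A B x : stepwise F -> A \in F -> B \in F -> A \subset B ->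
  x \in B -> x \notin A ->
  exists P, [/\ P \in F, toggle x P \in F, x \notin P, A \subset P & x |: P \subset B].
Proof.
move=> st + BF + xB.
move: {2}#|_| (leqnn #|B :\: A|) => n; elim: n A => [|n IH] A le AF AB xA.
  by move: le; rewrite leqn0 cards_eq0 setD_eq0 => /subsetP/(_ _ xB); rewrite (negPf xA).
have neAB : A != B by apply: contraNneq xA => ->.
case: (st _ _ AF BF neAB) => y; rewrite in_symdiff => yAB tF.
have [yA yB] : y \notin A /\ y \in B.
  by move: yAB; case: (boolP (y \in A)) => // yA; rewrite (subsetP AB _ yA).
have yAB' : y |: A \subset B by rewrite subUset sub1set yB.
case: (eqVneq x y) => [xy|xy].
  by exists A; rewrite xy; split.
rewrite toggle_notin // in tF.
case: (IH (y |: A)) => //.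
- rewrite -ltnS; apply: leq_trans le; apply: proper_card.
  apply/properP; split; first by apply: setDS; apply: subsetUr.
  by exists y; rewrite !inE ?eqxx ?yA.
- by rewrite !inE (negPf xy).
move=> P [PF tPF xP sP PB]; exists P; split=> //.
by apply: subset_trans sP; apply: subsetUr.
Qed.

(** * Chains *)

Definition total_family F : Prop := forall A B, A \in F -> B \in F ->
  (A \subset B) || (B \subset A).

(** If [x] lies in [D] but not in [E], an edge labelled [x] occurs between [B0] and [D] and another
    between [E] and [C0]. They are the same edge, which therefore lies above [E] and below [D]. *)
Lemma bounded_unique_total F B0 C0 : stepwise F -> unique_labels F ->
  B0 \in F -> C0 \in F -> (forall A, A \in F -> (B0 \subset A) && (A \subset C0)) ->
  total_family F.
Proof.
move=> st un BF CF bd D E DF EF.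
case: (boolP (D \subset E)) => // /subsetPn[x xD xE] /=.
have /andP[BD DC] := bd _ DF; have /andP[BE EC] := bd _ EF.
have xB : x \notin B0 by apply: contra xE; apply: (subsetP BE).
have xC : x \in C0 by apply: (subsetP DC).
case: (edge_between st BF DF BD xD xB) => P [PF tPF xP _ PD].
case: (edge_between st EF CF EC xC xE) => Q [QF tQF xQ EQ _].
apply: subset_trans EQ _; rewrite (un x Q P) //.
by apply: subset_trans PD; apply: subsetUr.
Qed.

Lemma total_stepwise_full_chain F : total_family F -> stepwise F -> full_chain F.
Proof.
move=> tot st; pose r := fun A B : {set X} => A \subset B.
pose s := sort r (enum F).
have sF A : (A \in s) = (A \in F) by rewrite mem_sort mem_enum.
exists s; first exact: (permEl (perm_sort _ _)).
have rs : sorted r s.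
  apply: (@sort_sorted_in _ [in F]); last by apply/allP => A; rewrite mem_enum.
  by move=> A B AF BF; apply: tot.
have us : uniq s by rewrite sort_uniq enum_uniq.
have rtr : transitive r by move=> B A C; apply: subset_trans.
have nthr := sorted_leq_nth rtr (fun A => subxx A) set0 rs.
apply/(sortedP set0) => i lti.
have lti' := ltnW lti.
set A := nth set0 s i; set B := nth set0 s i.+1.
have AF : A \in F by rewrite -sF mem_nth.
have BF : B \in F by rewrite -sF mem_nth.
have AB : A \subset B by apply: nthr => //; rewrite ?inE.
have neAB : A != B by rewrite nth_uniq // neq_ltn ltnSn.
rewrite AB /=; case: (st _ _ AF BF neAB) => x; rewrite in_symdiff => xAB tF.
have [xA xB] : x \notin A /\ x \in B.
  by move: xAB; case: (boolP (x \in A)) => // xA; rewrite (subsetP AB _ xA).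
(* The step from [A] towards its successor [B] gives a member between them, which must be [B]
   because no index lies strictly between theirs. *)
suff -> : B = x |: A by rewrite setDUl setDv setU0 (setDidPl _) ?cards1 // disjoints1.
rewrite toggle_notin // in tF.
apply/eqP; rewrite eqEsubset subUset sub1set xB AB !andbT.
have tS : x |: A \in s by rewrite sF.
have ltj : index (x |: A) s < size s by rewrite index_mem.
case: (leqP (index (x |: A) s) i) => [ji|ij].
  have := nthr _ _ ltj lti' ji; rewrite /r nth_index // -/A => /subsetP/(_ x).
  by rewrite !inE eqxx (negPf xA) => /(_ isT).
by have := nthr _ _ lti ltj ij; rewrite nth_index.
Qed.

                                                                               
                                                             
(** Deletions suffice: if [A] is contained in [B], delete elements from [B] until [A] is reached;
    the last deletion, reversed, is the step out of [A]. *)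
Lemma shrinkable_stepwise F :
  (forall A B, A \in F -> B \in F -> ~~ (A \subset B) ->
     exists2 x, x \in A :\: B & toggle x A \in F) -> stepwise F.
Proof.
move=> sh A B AF BF neAB.
case: (boolP (A \subset B)) => [AB|nAB]; last first.
  case: (sh _ _ AF BF nAB) => x /setDP[xA xB] tF; exists x => //.
  by rewrite in_symdiff xA (negPf xB).
move: {2}#|_| (leqnn #|B :\: A|) => n; elim: n B BF neAB AB => [|n IH] B BF neAB AB le.
  move: le; rewrite leqn0 cards_eq0 setD_eq0 => BA.
  by case/eqP: neAB; apply/eqP; rewrite eqEsubset AB.
have nBA : ~~ (B \subset A) by apply: contra neAB => BA; rewrite eqEsubset AB.
case: (sh _ _ BF AF nBA) => x /setDP[xB xA]; have tE := toggle_in xB; rewrite tE => tF.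
have xAB : x \in symdiff A B by rewrite in_symdiff xB (negPf xA).
case: (eqVneq A (B :\ x)) => [AE|ne].
  by exists x => //; rewrite AE -tE toggleK.
case: (IH _ tF ne).
- by rewrite subsetD1 AB.
- rewrite -ltnS; apply: leq_trans le; apply: proper_card; apply/properP; split.
    by apply: setSD; apply: subsetDl.
  by exists x; rewrite !inE ?xA ?xB ?eqxx.
move=> y yA tyF; exists y => //; move: yA; rewrite !in_symdiff !inE.
case: (boolP (y \in A)) => yA /=; last by case/andP.
case: eqP => [yx|//]; by rewrite yx (negPf xA) in yA.
Qed.

Lemma full_chain_total_stepwise F : full_chain F -> total_family F /\ stepwise F.
Proof.
case=> s pF srt.
have sF A : (A \in s) = (A \in F) by rewrite (perm_mem pF) mem_enum.
have rtr : transitive (fun A B : {set X} => A \subset B) by move=> B A C; apply: subset_trans.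
have srt' : sorted (fun A B : {set X} => A \subset B) s.
  by apply: sub_sorted srt => A B /andP[].
have nthr := sorted_leq_nth rtr (fun A => subxx A) set0 srt'.
have tot : total_family F.
  move=> A B; rewrite -!sF => As Bs.
  rewrite -(nth_index set0 As) -(nth_index set0 Bs).
  case/orP: (leq_total (index A s) (index B s)) => le; apply/orP; [left|right];
  by apply: nthr => //; rewrite inE index_mem.
split=> //; apply: shrinkable_stepwise => A B; rewrite -!sF => As Bs nAB.
have iA : index A s < size s by rewrite index_mem.
have iB : index B s < size s by rewrite index_mem.
have ltBA : index B s < index A s.
  rewrite ltnNge; apply: contra nAB => /(nthr _ _ iA iB).
  by rewrite !nth_index.
case iE: (index A s) => [|i] in iA ltBA *; first by [].
have /andP[sP /cards1P[x xE]] := sortedP set0 srt i iA.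
rewrite -iE nth_index // in sP xE.
have := set11 x; rewrite -xE inE => /andP[xP xA].
exists x.
  rewrite inE xA andbT; apply: contra xP => xB.
  have := nthr _ _ iB (ltnW iA) ltBA; rewrite nth_index // => /subsetP; exact.
rewrite toggle_in //.
suff -> : A :\ x = nth set0 s i by rewrite -sF; apply: mem_nth; apply: ltnW.
by rewrite -xE setDDr setDv set0U (setIidPr sP).
Qed.

End Families.

(** * Dual families expressed inside the original family *)

Section Dual.
Variable X : finType.
Implicit Types (F : {set {set X}}) (A B C M P D : {set X}) (x y z : X).

                                                                            
                                                                            
                       
(** The condition [stepwise] for the dual sets of elements of [D], read in [F]: [A] witnesses that
    the dual sets of [x] and [y] differ, [M] is the symbol toggled, and [z] represents the resulting
    dual set. *)
Definition dual_step F D : Prop := forall x y A,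
  x \in D -> y \in D -> A \in F -> (x \in A) != (y \in A) ->
  exists M z, [/\ M \in F, z \in D, (x \in M) != (y \in M)
    & forall B, B \in F -> (z \in B) = (x \in B) (+) (B == M)].

Lemma in_dual_set F x (u : member F) : (u \in dual_set F x) = (x \in val u).
Proof. by rewrite inE. Qed.

Lemma dual_set_toggleP F x z (M : member F) :
  toggle M (dual_set F x) = dual_set F z <->
  (forall B, B \in F -> (z \in B) = (x \in B) (+) (B == val M)).
Proof.
split=> [/setP E B BF|E].
  by have := E (exist _ B BF); rewrite in_toggle !in_dual_set -val_eqE /= => ->.
by apply/setP => u; rewrite in_toggle !in_dual_set -val_eqE E ?(valP u).
Qed.

Lemma dual_stepP F D : stepwise (dual_set F @: D) <-> dual_step F D.
Proof.
split=> [st x y A xD yD AF xyA|st _ _ /imsetP[x xD ->] /imsetP[y yD ->] ne].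
  case: (st _ _ (imset_f _ xD) (imset_f _ yD)).
    by apply: contraNneq xyA => /setP/(_ (exist _ A AF)); rewrite !in_dual_set => ->.
  move=> M; rewrite in_symdiff !in_dual_set => xyM /imsetP[z zD /dual_set_toggleP E].
  exists (val M), z; split=> //; first exact: valP.
  by move: xyM; do 2!case: (_ \in _).
have [u] : exists u, u \in symdiff (dual_set F x) (dual_set F y).
  by apply/set0Pn; rewrite symdiff_eq0.
rewrite in_symdiff !in_dual_set => xyu.
have xyu' : (x \in val u) != (y \in val u) by move: xyu; do 2!case: (_ \in _).
case: (st _ _ _ xD yD (valP u) xyu') => M [z [MF zD xyM E]].
exists (exist _ M MF).
  by rewrite in_symdiff !in_dual_set; move: xyM; rewrite /=; do 2!case: (_ \in _).
by apply/imsetP; exists z => //; apply/dual_set_toggleP.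
Qed.

Lemma dualE F : dual F = dual_set F @: [set: X].
Proof. by apply/setP => a; apply/imsetP/imsetP => -[x _ ->]; exists x. Qed.

Lemma non_ess F z A B : z \notin ess F -> A \in F -> B \in F -> (z \in A) = (z \in B).
Proof.
move=> zE AF BF; apply/eqP; apply: contraNT zE => ne; apply: (in_ess AF BF).
by rewrite in_symdiff; move: ne; do 2!case: (_ \in _).
Qed.

(** * Counting a family against its dual *)

Definition has_bottom F D := [exists A in F, [disjoint A & D]].
Definition has_top F D := [exists A in F, D \subset A].
Definition has_void F D := [exists x in D, [forall A in F, x \notin A]].
Definition has_full F D := [exists x in D, [forall A in F, x \in A]].

Lemma card_sdual_le F D :
  #|dual_set F @: D| <= #|ess F| + has_void F D + has_full F D.
Proof.
pose U := (dual_set F @: ess F :|: (if has_void F D then [set set0] else set0))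
  :|: (if has_full F D then [set setT] else set0).
apply: (@leq_trans #|U|).
  apply/subset_leq_card/subsetP => _ /imsetP[x xD ->]; rewrite /U.
  case: (boolP (x \in ess F)) => xE; first by rewrite !inE imset_f.
  case: (boolP [exists A in F, x \in A]) => xA.
    suff xfull : [forall A in F, x \in A].
      have -> : dual_set F x = setT.
        by apply/setP => u; rewrite in_dual_set inE; apply: (forall_inP xfull); apply: valP.
      have -> : has_full F D by apply/exists_inP; exists x.
      by rewrite !inE eqxx !orbT.
    apply/forall_inP => B BF; case/exists_inP: xA => A AF xA.
    by rewrite (non_ess xE BF AF).
  have xvoid : [forall A in F, x \notin A].
    by apply/forall_inP => A AF; apply: contra xA => xA; apply/exists_inP; exists A.
  have -> : dual_set F x = set0.
    apply/setP => u; rewrite in_dual_set inE; apply: negbTE.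
    by apply: (forall_inP xvoid); apply: valP.
  have -> : has_void F D by apply/exists_inP; exists x.
  by rewrite !inE eqxx !orbT.
apply: leq_trans (leq_card_setU _ _) _; apply: leq_add; last first.
  by case: ifP; rewrite ?cards1 ?cards0.
apply: leq_trans (leq_card_setU _ _) _; apply: leq_add; first exact: leq_imset_card.
by case: ifP; rewrite ?cards1 ?cards0.
Qed.

(** A member that meets [D] without containing it has an essential symbol. There is at most one
    bottom and one top, since members agree outside [ess F] and so are determined by their trace on
    [D]. *)
Lemma card_family_le F D : ess F \subset D ->
  #|F| <= #|ess (dual_set F @: D)| + has_bottom F D + has_top F D.
Proof.
move=> eD.
pose bots := [set A in F | [disjoint A & D]].
pose tops := [set A in F | D \subset A].
have le1 (S : {set {set X}}) (b : bool) : (forall A B, A \in S -> B \in S ->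
    [/\ A \in F, B \in F & forall z, z \in D -> (z \in A) = (z \in B)]) ->
    (S != set0 -> b) -> #|S| <= b.
  move=> SP Sb; case: (set_0Vmem S) => [->|[A AS]]; first by rewrite cards0.
  rewrite Sb; last by apply/set0Pn; exists A.
  apply/card_le1_eqP => B C BS CS; case: (SP B C BS CS) => BF CF E.
  apply/setP => z; case: (boolP (z \in D)) => zD; first by rewrite E.
  by rewrite (@non_ess F z B C) //; apply: contra zD; apply: (subsetP eD).
apply: (@leq_trans #|(@sval _ _ @: ess (dual_set F @: D) :|: bots) :|: tops|).
  apply/subset_leq_card/subsetP => A AF.
  case: (boolP (A \in bots)) => Ab; first by rewrite 2!in_setU Ab orbT.
  case: (boolP (A \in tops)) => At; first by rewrite in_setU At orbT.
  rewrite in_setU in_setU; apply/orP; left; apply/orP; left.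
  move: Ab At; rewrite !inE AF /=.
  rewrite -setI_eq0 => /set0Pn[x /setIP[xA xD]] /subsetPn[y yD yA].
  apply/imsetP; exists (exist _ A AF) => //.
  apply/essP; exists (dual_set F x), (dual_set F y).
  by rewrite !imset_f // !in_dual_set.
apply: leq_trans (leq_card_setU _ _) _; apply: leq_add.
  apply: leq_trans (leq_card_setU _ _) _; apply: leq_add; first exact: leq_imset_card.
  apply: le1 => [A B|/set0Pn[A]].
    rewrite !inE => /andP[AF dA] /andP[BF dB]; split=> // z zD.
    by rewrite (disjointFl dA zD) (disjointFl dB zD).
  by rewrite inE => /andP[AF dA]; apply/exists_inP; exists A.
apply: le1 => [A B|/set0Pn[A]].
  rewrite !inE => /andP[AF dA] /andP[BF dB]; split=> // z zD.
  by rewrite (subsetP dA _ zD) (subsetP dB _ zD).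
by rewrite inE => /andP[AF dA]; apply/exists_inP; exists A.
Qed.

                                                                  
                                                 
(** The two lower bounds from [card_ess_lt] and the two upper bounds from [card_sdual_le] and
    [card_family_le] differ by at most two in total, because bottom excludes full and top excludes
    void; the two strict inequalities use up this slack. *)
Lemma dual_step_counting F D : F != set0 -> D != set0 -> ess F \subset D ->
  stepwise F -> dual_step F D ->
  [/\ #|F| = #|ess F|.+1,
      #|dual_set F @: D| <= #|ess (dual_set F @: D)|.+1,
      has_bottom F D || has_full F D & has_top F D || has_void F D].
Proof.
move=> F0 D0 eD stF /dual_stepP stG.
have G0 : dual_set F @: D != set0 by rewrite imset_eq0.
have lt1 := card_ess_lt F0 stF; have lt2 := card_ess_lt G0 stG.
have le1 := card_sdual_le F D; have le2 := card_family_le eD.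
have bf : ~~ (has_bottom F D && has_full F D).
  apply/negP => /andP[/exists_inP[A AF dA] /exists_inP[x xD /forall_inP/(_ A AF)]].
  by rewrite (disjointFl dA xD).
have tv : ~~ (has_top F D && has_void F D).
  apply/negP => /andP[/exists_inP[A AF dA] /exists_inP[x xD /forall_inP/(_ A AF)]].
  by rewrite (subsetP dA _ xD).
have arith (f e g h : nat) (b u t v : bool) : e < f -> h < g ->
    g <= e + v + u -> f <= h + b + t -> ~~ (b && u) -> ~~ (t && v) ->
    [/\ f = e.+1, g <= h.+1, b || u & t || v].
  by case: b; case: u; case: t; case: v => //= *; split=> //; lia.
exact: arith lt1 lt2 le1 le2 bf tv.
Qed.

                                                                               
                     
(** The dual set of [x] is the up-set of a least member [A0]. If it is not contained in that of [y],
    then [y] is not in [A0], and deleting [A0] is a step towards [y] whose result is the dual set of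
    [z]. *)
Lemma dual_step_of_least F D :
  (forall x A, x \in D -> A \in F -> x \in A -> exists A0,
     [/\ A0 \in F, x \in A0 & forall B, B \in F -> (x \in B) = (A0 \subset B)]) ->
  (forall x y A0, x \in D -> y \in D -> A0 \in F -> x \in A0 -> y \notin A0 ->
     exists2 z, z \in D & forall B, B \in F -> (z \in B) = (A0 \proper B)) ->
  dual_step F D.
Proof.
move=> least above; apply/dual_stepP/shrinkable_stepwise.
move=> _ _ /imsetP[x xD ->] /imsetP[y yD ->] /subsetPn[u]; rewrite !in_dual_set => xu yu.
case: (least _ _ xD (valP u) xu) => A0 [A0F xA0 A0le].
have yA0 : y \notin A0.
  by apply: contra yu; apply: subsetP; rewrite -A0le // (valP u).
case: (above _ _ _ xD yD A0F xA0 yA0) => z zD zE.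
exists (exist _ A0 A0F); first by rewrite in_setD !in_dual_set xA0 yA0.
apply/imsetP; exists z => //; apply/dual_set_toggleP => B BF /=.
rewrite zE // A0le // properEneq eq_sym.
by case: eqP => [->|_]; rewrite ?subxx ?addbF.
Qed.

Lemma total_dual_step F D : total_family F -> stepwise F -> ess F \subset D ->
  dual_step F D.
Proof.
move=> tot st eD; apply: dual_step_of_least => [x A xD AF xA|x y A0 xD yD A0F xA0 yA0].
  have PA : (A \in F) && (x \in A) by rewrite AF.
  case: (@arg_minnP _ A (fun B => (B \in F) && (x \in B)) (fun B => #|B|) PA).
  move=> A0 /andP[A0F xA0] minA0; exists A0; split=> // B BF.
  apply/idP/idP => [xB|]; last by move/subsetP; apply.
  case/orP: (tot _ _ A0F BF) => // BA0.
  have := minA0 B; rewrite BF xB => /(_ isT) le.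
  by have /eqP -> : B == A0 by rewrite eqEcard BA0.
case: (boolP [exists B in F, A0 \proper B]) => [/exists_inP[B BF A0B]|no].
  have [sA0B _] := andP A0B.
  case: (st _ _ A0F BF (proper_neq A0B)) => b; rewrite in_symdiff => bA0B tF.
  have bA0 : b \notin A0 by move: bA0B; case: (boolP (b \in A0)) => // /(subsetP sA0B) ->.
  exists b => [|C CF].
    by apply: (subsetP eD); apply: (in_ess A0F BF); rewrite in_symdiff.
  rewrite toggle_notin // in tF.
  apply/idP/idP => [bC|A0C].
    apply/properP; split; last by exists b.
    by case/orP: (tot _ _ A0F CF) => // /subsetP/(_ _ bC); rewrite (negPf bA0).
  case/orP: (tot _ _ tF CF) => [/subsetP-> //|sC]; first by rewrite !inE eqxx.
  apply: contraTT A0C => bC; rewrite properE negb_and negbK orbC.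
  apply/orP; left; apply/subsetP => z zC; have := subsetP sC _ zC; rewrite !inE.
  by case: eqP => // zb; rewrite zb (negPf bC) in zC.
(* Here [A0] is the greatest member, so [y] lies in no member and represents the empty dual set. *)
exists y => // B BF.
have -> : A0 \proper B = false by apply: contraNF no => ?; apply/exists_inP; exists B.
apply: contraNF yA0 => yB.
case/orP: (tot _ _ A0F BF) => [A0B|/subsetP-> //].
apply: contraR no => yA0; apply/exists_inP; exists B => //.
by apply/properP; split=> //; exists y.
Qed.

Lemma total_of_total_dual F D : ess F \subset D -> total_family (dual_set F @: D) ->
  total_family F.
Proof.
move=> eD tot A B AF BF; case: (boolP (A \subset B)) => // /subsetPn[x xA xB] /=.
apply/subsetP => y yB; apply/negPn/negP => yA.
have xD : x \in D by apply: (subsetP eD); apply/essP; exists A, B.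
have yD : y \in D by apply: (subsetP eD); apply/essP; exists B, A.
case/orP: (tot _ _ (imset_f _ xD) (imset_f _ yD)) => /subsetP E.
  by have := E (exist _ A AF); rewrite !in_dual_set /= xA (negPf yA) => /(_ isT).
by have := E (exist _ B BF); rewrite !in_dual_set /= yB (negPf xB) => /(_ isT).
Qed.

(** Complementing all members reverses the edges and keeps their labels, which reduces downward
    stars to upward ones. *)
Definition compl F : {set {set X}} := @setC X @: F.

Lemma in_compl F A : (A \in compl F) = (~: A \in F).
Proof.
apply/imsetP/idP => [[B BF ->]|AF]; first by rewrite setCK.
by exists (~: A); rewrite ?setCK.
Qed.

Lemma complK : involutive compl.
Proof. by move=> F; apply/setP => A; rewrite !in_compl setCK. Qed.

Lemma setC_toggle x A : ~: toggle x A = toggle x (~: A).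
Proof. by apply/setP => z; rewrite in_setC !in_toggle in_setC; rewrite addNb. Qed.

Lemma symdiff_setC A B : symdiff (~: A) (~: B) = symdiff A B.
Proof. by apply/setP => z; rewrite !in_symdiff !in_setC addbN addNb negbK. Qed.

Lemma stepwise_compl F : stepwise F -> stepwise (compl F).
Proof.
move=> st A B; rewrite !in_compl => AF BF neAB.
case: (st _ _ AF BF); first by rewrite (inj_eq (can_inj (@setCK X))).
by move=> x; rewrite symdiff_setC -setC_toggle => ? ?; exists x; rewrite ?in_compl.
Qed.

Lemma total_compl F : total_family F -> total_family (compl F).
Proof.
move=> tot A B; rewrite !in_compl => AF BF.
by move: (tot _ _ AF BF); rewrite !setCS orbC.
Qed.

Lemma unique_labels_compl F : unique_labels F -> unique_labels (compl F).
Proof.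
move=> un x A C; rewrite !in_compl !setC_toggle => AF CF tA tC xA xC.
apply: (can_inj (@setCK X)); apply: (can_inj (toggleK x)).
by apply: (un x) => //; rewrite ?toggleK // in_toggle in_setC eqxx ?(negPf xA) ?(negPf xC).
Qed.

Lemma dual_step_compl F D : dual_step F D -> dual_step (compl F) D.
Proof.
move=> st x y A xD yD; rewrite in_compl => AF xyA.
case: (st x y _ xD yD AF); first by rewrite !in_setC (inj_eq negb_inj).
move=> M [z [MF zD xyM E]]; exists (~: M), z; split=> //.
- by rewrite in_compl setCK.
- by rewrite !in_setC (inj_eq negb_inj).
move=> B; rewrite in_compl => /E; rewrite !in_setC (can2_eq (@setCK X) (@setCK X)).
by case: (z \in B); case: (x \in B); case: (_ == _).
Qed.

Definition labels F A := [set x | toggle x A \in F].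

Lemma labels_compl F A : labels (compl F) (~: A) = labels F A.
Proof. by apply/setP => x; rewrite !inE in_compl setC_toggle setCK. Qed.

(** Starlikeness without graphs: under unique labels, [stepwise] amounts to connectedness, and
    acyclicity is automatic. *)
Definition star F A : Prop := [/\ stepwise F, unique_labels F, 2 <= #|labels F A|
  & forall B, B \in F -> B != A -> #|labels F B| <= 2].

Lemma star_compl F A : star F A -> star (compl F) (~: A).
Proof.
case=> st un ge le; split.
- exact: stepwise_compl.
- exact: unique_labels_compl.
- by rewrite labels_compl.
move=> B; rewrite in_compl => BF BA; rewrite -(setCK B) labels_compl le //.
by rewrite (can2_eq (@setCK X) (@setCK X)).
Qed.

Definition out_unique F A : Prop := forall x y,
  toggle x A \in F -> toggle y A \in F -> x \notin A -> y \notin A -> x = y.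

(** While [A] differs from both [B] and [C], the steps towards them use the same upward edge, so [A]
    can be replaced by its upper end. *)
Lemma total_above F A : stepwise F -> A \in F ->
  (forall B, B \in F -> A \subset B -> out_unique F B) ->
  forall B C, B \in F -> C \in F -> A \subset B -> A \subset C ->
  (B \subset C) || (C \subset B).
Proof.
move=> st AF out B C BF CF.
move: {2}#|_| (leqnn #|B :\: A|) => n; elim: n A AF out => [|n IH] A AF out le AB AC.
  by move: le; rewrite leqn0 cards_eq0 setD_eq0 => BA; rewrite (subset_trans BA AC).
case: (eqVneq A B) => [<-|neB]; first by rewrite AC.
case: (eqVneq A C) => [<-|neC]; first by rewrite AB orbT.
have up E : E \in F -> A \subset E -> A != E ->
    exists b, [/\ b \notin A, b \in E & toggle b A \in F].
  move=> EF AE neE; case: (st _ _ AF EF neE) => b; rewrite in_symdiff => bAE tF.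
  exists b; move: bAE; case: (boolP (b \in A)) => [/(subsetP AE) -> //|//].
case: (up B) => // b [bA bB tb]; case: (up C) => // c [cA cC tc].
have bc : b = c by apply: (out A).
rewrite -bc toggle_notin // in tb cC.
apply: (IH (b |: A)) => //.
- move=> E EF sE; apply: out => //; apply: subset_trans sE; exact: subsetUr.
- rewrite -ltnS; apply: leq_trans le; apply: proper_card.
  apply/properP; split; first by apply: setDS; apply: subsetUr.
  by exists b; rewrite !inE ?eqxx ?bA.
- by rewrite subUset sub1set bB.
- by rewrite subUset sub1set cC.
Qed.

(** * Families with unique labels containing the empty set *)

Section Rooted.
Variable F : {set {set X}}.
Hypotheses (st : stepwise F) (un : unique_labels F) (F0 : set0 \in F).

(** Climbing from the empty set to a member containing [x] crosses the only edge labelled [x]. *)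
Lemma label_edge x A B : A \in F -> toggle x A \in F -> x \notin A ->
  B \in F -> (x \in B) = (x |: A \subset B).
Proof.
move=> AF tF xA BF; apply/idP/idP => [xB|/subsetP-> //]; last by rewrite !inE eqxx.
case: (edge_between st F0 BF (sub0set _) xB) => [|P [PF tP xP _ PB]]; first by rewrite inE.
by rewrite (@un x A P).
Qed.

Lemma in_label A : A \in F -> A != set0 -> exists2 a, a \in A & toggle a A \in F.
Proof.
move=> AF A0; case: (st AF F0 A0) => a; rewrite in_symdiff inE addbF.
by exists a.
Qed.

Lemma in_unique A x y : A \in F -> toggle x A \in F -> toggle y A \in F ->
  x \in A -> y \in A -> x = y.
Proof.
move=> AF tx ty xA yA; apply/eqP/negPn/negP => xy.
(* Every member containing [y] contains [A], yet [toggle x A] contains [y] and misses [x]. *)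
have := @label_edge y (toggle y A) (toggle x A) ty.
rewrite toggleK !in_toggle eqxx yA => /(_ AF isT tx).
rewrite eq_sym (negPf xy) /= => /esym/subsetP/(_ x).
rewrite in_toggle xA eqxx => E; have : x \in y |: toggle y A.
  by rewrite in_setU1 in_toggle xA (negPf xy).
by move/E.
Qed.

(** One label at [A] is spent on the edge towards the empty set. *)
Lemma out_unique_of_labels A : A \in F -> A != set0 -> #|labels F A| <= 2 ->
  out_unique F A.
Proof.
move=> AF A0 le x y tx ty xA yA; apply/eqP/negPn/negP => xy.
case: (in_label AF A0) => a aA ta.
have : #|[set a; x; y]| <= #|labels F A|.
  by apply/subset_leq_card/subsetP => z; rewrite !inE => /orP[/orP[]|] /eqP->.
rewrite setUC cardsU1 cards2 !inE (eq_sym y x) (negPf xy).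
have -> : y == a = false by apply: contraNF yA => /eqP->.
have -> : a == x = false by apply: contraNF xA => /eqP<-.
by move/leq_trans/(_ le).
Qed.

Lemma labels_le_out A : A \in F -> out_unique F A -> #|labels F A| <= 2.
Proof.
move=> AF out; rewrite -(cardsID A).
apply: (@leq_add _ _ 1 1); apply/card_le1_eqP => x y; rewrite !inE.
  by move=> /andP[tx xA] /andP[ty yA]; apply: (in_unique AF).
by move=> /andP[xA tx] /andP[yA ty]; apply: out.
Qed.

Section Void.
Variable x0 : X.
Hypothesis (x0F : forall A, A \in F -> x0 \notin A).

Lemma rooted_dual_step : (forall A, A \in F -> A != set0 -> out_unique F A) ->
  dual_step F setT.
Proof.
move=> out; apply: dual_step_of_least => [x A _ AF xA|x y A0 _ _ A0F xA0 yA0].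
  case: (edge_between st F0 AF (sub0set _) xA) => [|P [PF tP xP _ _]]; first by rewrite inE.
  exists (x |: P); rewrite !inE eqxx -(toggle_notin xP) tP; split=> // B BF.
  by rewrite (toggle_notin xP); apply: label_edge.
have nA0 : A0 != set0 by apply/set0Pn; exists x.
have up B : B \in F -> A0 \proper B ->
    exists b, [/\ b \notin A0, b \in B & toggle b A0 \in F].
  move=> BF A0B; have [sA0B _] := andP A0B.
  case: (st A0F BF (proper_neq A0B)) => b; rewrite in_symdiff => bA tF.
  exists b; move: bA; case: (boolP (b \in A0)) => [/(subsetP sA0B) -> //|//].
case: (boolP [exists B in F, A0 \proper B]) => [/exists_inP[B BF A0B]|no].
  case: (up B) => // b [bA0 bB tb]; exists b; first by rewrite inE.
  move=> C CF; apply/idP/idP => [|A0C].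
    rewrite (label_edge A0F tb bA0 CF) => /subsetP sC.
    apply/properP; split; last by exists b; rewrite // sC // !inE eqxx.
    by apply/subsetP => z zA0; rewrite sC // !inE zA0 orbT.
  case: (up C) => // c [cA0 cC tc].
  by rewrite (out A0 A0F nA0 b c).
(* Nothing lies strictly above [A0], and [x0] represents the empty dual set. *)
exists x0 => [|B BF]; first by rewrite inE.
rewrite (negPf (x0F BF)); apply/esym/negbTE.
by apply: contra no => ?; apply/exists_inP; exists B.
Qed.

                                                                             
                                                      
(** For the label [a] of an edge entering [A], the dual set of [a] is the up-set of [A]. A step from
    it towards the empty dual set of [x0] deletes one symbol, necessarily that of [A]. The resulting
    [z] lies exactly in the members strictly above [A], so every upward edge at [A] is labelled
    [z]. *)
Lemma dual_step_out_unique : dual_step F setT ->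
  forall A, A \in F -> A != set0 -> out_unique F A.
Proof.
move=> dst A AF A0 b c tb tc bA cA.
case: (in_label AF A0) => a aA ta.
have aE B : B \in F -> (a \in B) = (A \subset B).
  move=> BF; rewrite (@label_edge a (toggle a A)) ?toggleK //.
    by rewrite toggle_in // setD1K.
  by rewrite in_toggle aA eqxx.
case: (dst a x0 A) => //; first by rewrite aA (negPf (x0F AF)).
move=> M [z [MF _ aM zE]].
rewrite (negPf (x0F MF)) eqbF_neg negbK in aM.
have zM : z \notin M by rewrite zE // aM eqxx.
have MA : M = A.
  apply/eqP/negPn/negP => MA; case/negP: zM.
  have zA : z \in A by rewrite zE // aA eq_sym (negPf MA).
  by move: aM; rewrite aE // => /subsetP; apply.
have outz d : d \notin A -> toggle d A \in F -> d = z.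
  move=> dA td; have : z \in toggle d A.
    rewrite zE // in_toggle aA MA; have -> : (a == d) = false.
      by apply: contraNF dA => /eqP<-.
    by apply/eqP => /setP/(_ d); rewrite in_toggle eqxx (negPf dA).
  by rewrite in_toggle -MA (negPf zM) => /eqP.
by rewrite (outz b bA tb) (outz c cA tc).
Qed.

Lemma rooted_dichotomy : dual_step F setT -> total_family F \/ star F set0.
Proof.
move=> dst; have out := dual_step_out_unique dst.
case: (leqP 2 #|labels F set0|) => [ge|lt]; [right|left].
  by split=> // B BF B0; apply: labels_le_out => //; apply: out.
move=> A B AF BF; apply: (total_above st F0) => //; try exact: sub0set.
move=> C CF _; case: (eqVneq C set0) => [->|]; last exact: out.
move=> x y tx ty _ _; move: lt; rewrite ltnS => /card_le1_eqP; apply; rewrite inE //.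
Qed.

End Void.

End Rooted.

Lemma upward_dual_step F x0 : set0 \in F -> (forall A, A \in F -> x0 \notin A) ->
  star F set0 -> dual_step F setT.
Proof.
move=> F0 x0F [st un _ le]; apply: (rooted_dual_step st un F0 x0F) => A AF A0.
by apply: out_unique_of_labels => //; apply: le.
Qed.

Lemma downward_dual_step F x1 : setT \in F -> (forall A, A \in F -> x1 \in A) ->
  star F setT -> dual_step F setT.
Proof.
move=> FT x1F /star_compl; rewrite setCT => sF; rewrite -(complK F).
apply/dual_step_compl/(@upward_dual_step _ x1) => [|A|//].
  by rewrite in_compl setC0.
by rewrite in_compl => /x1F; rewrite inE.
Qed.

Lemma corooted_dichotomy F x1 : stepwise F -> unique_labels F -> setT \in F ->
  (forall A, A \in F -> x1 \in A) -> dual_step F setT ->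
  total_family F \/ star F setT.
Proof.
move=> st un FT x1F dst.
have [|||A|||] := @rooted_dichotomy (compl F) _ _ _ x1.
- exact: stepwise_compl.
- exact: unique_labels_compl.
- by rewrite in_compl setC0.
- by rewrite in_compl => /x1F; rewrite inE.
- exact: dual_step_compl.
- by move/total_compl; rewrite complK; left.
by move/star_compl; rewrite complK setC0; right.
Qed.

(** * The extremal cases that force chains *)

Lemma bottom_top_total F D : ess F \subset D -> stepwise F -> unique_labels F ->
  has_bottom F D -> has_top F D -> total_family F.
Proof.
move=> eD st un /exists_inP[B BF dB] /exists_inP[C CF sC].
apply: (bounded_unique_total st un BF CF) => A AF; apply/andP; split; apply/subsetP => z zz.
  rewrite (@non_ess F z A B) //; have := disjointFr dB zz.
  by move/negbT; apply: contra; apply: (subsetP eD).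
case: (boolP (z \in D)) => [/(subsetP sC) //|zD].
by rewrite (@non_ess F z C A) //; apply: contra zD; apply: (subsetP eD).
Qed.

(** The void and full elements make [set0] and [setT] dual sets, so [bounded_unique_total] applies
    to the dual family, and comparability carries back to [F]. *)
Lemma void_full_total F D : ess F \subset D -> dual_step F D ->
  #|dual_set F @: D| <= #|ess (dual_set F @: D)|.+1 ->
  has_void F D -> has_full F D -> total_family F.
Proof.
move=> eD /dual_stepP st le /exists_inP[x0 x0D /forall_inP x0F] /exists_inP[x1 x1D /forall_inP x1F].
apply: (total_of_total_dual eD).
apply: (@bounded_unique_total _ _ set0 setT st) => [||| A _]; last by rewrite sub0set subsetT.
- exact: unique_labels_of_card.
- apply/imsetP; exists x0 => //; apply/setP => u.
  by rewrite in_dual_set inE (negPf (x0F _ (valP u))).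
- apply/imsetP; exists x1 => //; apply/setP => u.
  by rewrite in_dual_set inE (x1F _ (valP u)).
Qed.

End Dual.

(** * From graph conditions to set conditions *)

Section Starlike.
Variable X : finType.
Implicit Types (F : {set {set X}}) (A B C M P D : {set X}) (x y z : X).

Lemma degree_labels F (v : member F) :
  degree (one_inclusion_graph F) v = #|labels F (val v)|.
Proof.
have inj : injective (fun x => toggle x (val v)).
  move=> x y /setP/(_ x); rewrite !in_toggle eqxx => /addbI/esym/eqP //.
rewrite /degree -(card_imset _ inj) -(card_imset _ (@val_inj _ _ (member F))).
apply: eq_card => A; apply/imsetP/imsetP => [[u]|[x]].
  rewrite -[u \in _]/(adj _ v u) one_inclusion_adj => /existsP[x /eqP uE] ->.
  by exists x; rewrite // inE -uE (valP u).
rewrite inE => tF ->; exists (exist _ (toggle x (val v)) tF) => //.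
by rewrite -[_ \in _]/(adj _ v _) one_inclusion_adj; apply/existsP; exists x.
Qed.

Lemma unique_labelsP F :
  {in one_inclusion_graph F &, injective (fun e => e.2)} <-> unique_labels F.
Proof.
split=> [inj x A C AF CF tA tC xA xC|un [[u w] b] [[u' w'] b']].
  pose e B (BF : B \in F) (tB : toggle x B \in F) : member F * member F * X :=
    (exist _ B BF, exist _ (toggle x B) tB, x).
  have := inj (e A AF tA) (e C CF tC); rewrite !inE /= xA xC !toggle_notin // !eqxx.
  by move=> /(_ isT isT erefl) [].
rewrite !inE /= => /andP[bu /eqP wE] /andP[bu' /eqP wE'] bb'.
rewrite -bb' in bu' wE' *.
have uu : u = u'.
  apply/val_inj; apply: (un b); rewrite ?(valP u) ?(valP u') //.
    by rewrite toggle_notin // -wE (valP w).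
  by rewrite toggle_notin // -wE' (valP w').
by rewrite uu (_ : w = w') //; apply/val_inj; rewrite /= wE wE' uu.
Qed.

Lemma unique_edge F x A C : unique_labels F -> A \in F -> C \in F ->
  toggle x A \in F -> toggle x C \in F -> A = C \/ A = toggle x C.
Proof.
move=> un AF CF tA tC.
case: (boolP (x \in A)) => xA; case: (boolP (x \in C)) => xC.
- left; apply: (can_inj (toggleK x)).
  by apply: (un x); rewrite ?toggleK // in_toggle eqxx ?xA ?xC.
- right; apply: (can_inj (toggleK x)); rewrite toggleK.
  by apply: (un x); rewrite ?toggleK // in_toggle eqxx xA.
- right.
  by apply: (un x); rewrite ?toggleK // in_toggle eqxx xC.
- by left; apply: (un x).
Qed.

                                                                            
(** The only edge labelled [x] is incident to [u], so a path avoiding [u] never toggles [x]. *)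
Lemma path_avoiding F x (u w : member F) p : unique_labels F ->
  toggle x (val u) \in F -> u \notin w :: p ->
  path (adj (one_inclusion_graph F)) w p -> (x \in val (last w p)) = (x \in val w).
Proof.
move=> un tF; elim: p w => [|c p IH] w //=.
rewrite inE negb_or => /andP[uw ucp] /andP[+ pth].
rewrite one_inclusion_adj => /existsP[y /eqP cE].
rewrite IH // cE in_toggle; case: eqP => [xy|_]; last by rewrite addbF.
have tw : toggle x (val w) \in F by rewrite xy -cE (valP c).
case: (unique_edge un (valP u) (valP w) tF tw) => [/val_inj/eqP|].
  by rewrite (negPf uw).
rewrite xy -cE => /val_inj/eqP uc.
by move: ucp; rewrite inE uc.
Qed.

(** On a simple path from [A] to [B] the first label is never toggled again, so it separates [A]
    from [B]. *)
Lemma connected_stepwise F : connected (one_inclusion_graph F) -> unique_labels F ->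
  stepwise F.
Proof.
move=> con un A B AF BF neAB.
case/connectP: (con (exist _ A AF) (exist _ B BF)) => p0 /shortenP[p pth up _] lst.
case: p pth up lst => [|c p] /=; first by move=> _ _ [AB]; case/eqP: neAB.
case/andP; rewrite one_inclusion_adj => /existsP[x /eqP /= cE] pth /andP[uc _] lst.
have tF : toggle x A \in F by rewrite -cE (valP c).
exists x => //; have := @path_avoiding F x (exist _ A AF) c p un tF uc pth.
rewrite -lst /= cE in_symdiff in_toggle eqxx => ->.
by case: (x \in A).
Qed.

(** The label of the edge leaving [u] can only be undone by the edge closing the cycle; then both
    neighbours of [u] on the cycle coincide. *)
Lemma unique_labels_acyclic F : unique_labels F -> acyclic (one_inclusion_graph F).
Proof.
move=> un [|u [|w [|c p]]] // _ /andP[].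
rewrite /= rcons_path => /and3P[uw wc /andP[pth lu]] /andP[un1 /andP[un2 _]].
move: uw; rewrite one_inclusion_adj => /existsP[x /eqP wE].
have tF : toggle x (val u) \in F by rewrite -wE (valP w).
have pth' : path (adj (one_inclusion_graph F)) w (c :: p) by rewrite /= wc.
have := path_avoiding un tF un1 pth'.
rewrite /= wE in_toggle eqxx.
move: lu; rewrite one_inclusion_adj => /existsP[y /eqP uE].
set l := last c p in uE *.
have lcp : l \in c :: p by apply: mem_last.
rewrite uE in_toggle; case: (eqVneq x y) => [xy|_]; last by rewrite addbF; case: (_ \in _).
case/negP: un2; have -> // : w = l.
by apply/val_inj; rewrite wE uE xy toggleK.
Qed.

Lemma starlike_star F (v : member F) :
  starlike_centre (one_inclusion_graph F) v -> star F (val v).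
Proof.
case=> -[con _] /unique_labelsP un; rewrite degree_labels => ge _ le; split=> //.
  exact: connected_stepwise.
move=> B BF Bv; have := le (exist _ B BF); rewrite degree_labels; apply.
by rewrite -val_eqE.
Qed.

Lemma star_starlike F (v : member F) :
  is_source (one_inclusion_graph F) v \/ is_sink (one_inclusion_graph F) v ->
  star F (val v) -> starlike_centre (one_inclusion_graph F) v.
Proof.
move=> ss [st un ge le]; split=> //.
- split; last exact: unique_labels_acyclic.
  move=> u w; have /(_ u w) := (well_gradedP F).2 st.
  exact: dist_Some_connect.
- exact/unique_labelsP.
- by rewrite degree_labels.
- by move=> w wv; rewrite degree_labels le ?(valP w).
Qed.

Lemma source_set0 F (v : member F) : stepwise F -> val v = set0 ->
  is_source (one_inclusion_graph F) v.
Proof.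
move=> /well_gradedP wg v0 w z b; rewrite !inE /= => /andP[bw /eqP zE].
rewrite !wg /= v0 zE.
have sd0 A : symdiff A set0 = A by rewrite /symdiff setD0 set0D setU0.
by rewrite !sd0 cardsU1 bw.
Qed.

Lemma sink_setT F (v : member F) : stepwise F -> val v = setT ->
  is_sink (one_inclusion_graph F) v.
Proof.
move=> /well_gradedP wg vT w z b; rewrite !inE /= => /andP[bw /eqP zE].
rewrite !wg /= vT zE.
have sdT A : symdiff A setT = ~: A by rewrite /symdiff setDT set0U setTD.
rewrite !sdT; apply: proper_card; apply/properP; split.
  by rewrite setCS subsetUr.
by exists b; rewrite !inE ?eqxx.
Qed.

Lemma upward_starlikeP F : upward_starlike F <->
  [/\ set0 \in F, star F set0 & exists x, forall A, A \in F -> x \notin A].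
Proof.
split=> [[[v [v0 sv _]] ex]|[F0 sF ex]].
  by rewrite -v0; split=> //; [apply: valP|apply: starlike_star].
split=> //; pose v : member F := exist _ set0 F0; exists v.
have src : is_source (one_inclusion_graph F) v by case: sF => st _ _ _; apply: source_set0.
by split=> //; apply: star_starlike; first by left.
Qed.

Lemma downward_starlikeP F : downward_starlike F <->
  [/\ setT \in F, star F setT & exists x, forall A, A \in F -> x \in A].
Proof.
split=> [[[v [vT sv _]] ex]|[FT sF ex]].
  by rewrite -vT; split=> //; [apply: valP|apply: starlike_star].
split=> //; pose v : member F := exist _ setT FT; exists v.
have snk : is_sink (one_inclusion_graph F) v by case: sF => st _ _ _; apply: sink_setT.
by split=> //; apply: star_starlike; first by right.
Qed.

(** * Classification *)

Lemma well_graded_dualP F : well_graded (dual F) <-> dual_step F setT.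
Proof.
rewrite dualE; split=> [/well_gradedP/dual_stepP//|H].
exact/well_gradedP/dual_stepP.
Qed.

Lemma well_graded_ess_dualP F : well_graded (ess_dual F) <-> dual_step F (ess F).
Proof.
split=> [/well_gradedP/dual_stepP//|H].
exact/well_gradedP/dual_stepP.
Qed.

Lemma ess_set0_card F : F != set0 -> ess F = set0 -> total_family F /\ #|F| = 1.
Proof.
move=> /set0Pn[A AF] e0.
have eqA B : B \in F -> B = A.
  by move=> BF; apply/setP => z; apply: (non_ess _ BF AF); rewrite e0 inE.
split; first by move=> B C /eqA-> /eqA->; rewrite subxx.
apply/eqP/cards1P; exists A; apply/setP => B; rewrite inE.
by apply/idP/eqP => [/eqA|->].
Qed.

Lemma additionality1 F : #|F| = #|ess F|.+1 -> additionality F = 1%R.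
Proof. by rewrite /additionality => ->; lia. Qed.

Lemma full_chainP F : full_chain F <-> total_family F /\ stepwise F.
Proof.
split=> [|[]]; first exact: full_chain_total_stepwise.
exact: total_stepwise_full_chain.
Qed.

Lemma well_graded_dual_classification F : F != set0 -> stepwise F -> dual_step F setT ->
  #|F| = #|ess F|.+1 /\ (full_chain F \/ upward_starlike F \/ downward_starlike F).
Proof.
move=> F0 st dst.
(* On an empty domain the dual family is empty, so the counting does not apply. *)
have [T0|T0] := eqVneq [set: X] set0.
  have e0 : ess F = set0 by apply/eqP; rewrite -subset0 -T0 subsetT.
  have [tot c1] := ess_set0_card F0 e0.
  by rewrite c1 e0 cards0; split=> //; left; apply/full_chainP.
have eT := subsetT (ess F).
have [card leG bf tv] := dual_step_counting F0 T0 eT st dst.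
split=> //.
have un : unique_labels F by apply: unique_labels_of_card; rewrite // card.
have chain : total_family F -> full_chain F by move=> tot; apply/full_chainP.
case/orP: bf => bf; case/orP: tv => tv.
- by left; apply: chain; apply: (bottom_top_total eT).
- case/exists_inP: bf => A AF; rewrite -setI_eq0 setIT => /eqP A0; rewrite A0 in AF.
  case/exists_inP: tv => x0 _ /forall_inP x0F.
  case: (rooted_dichotomy st un AF x0F dst) => [/chain|sF]; first by left.
  by right; left; apply/upward_starlikeP; split=> //; exists x0.
- case/exists_inP: tv => A AF; rewrite subTset => /eqP AT; rewrite AT in AF.
  case/exists_inP: bf => x1 _ /forall_inP x1F.
  case: (corooted_dichotomy st un AF x1F dst) => [/chain|sF]; first by left.
  by right; right; apply/downward_starlikeP; split=> //; exists x1.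
- by left; apply: chain; apply: (void_full_total eT).
Qed.

Lemma well_graded_ess_dual_classification F : F != set0 -> stepwise F ->
  dual_step F (ess F) -> #|F| = #|ess F|.+1 /\ full_chain F.
Proof.
move=> F0 st dst.
have [e0|e0] := eqVneq (ess F) set0.
  have [tot c1] := ess_set0_card F0 e0.
  by rewrite c1 e0 cards0; split=> //; apply/full_chainP.
have [card leG bf tv] := dual_step_counting F0 e0 (subxx _) st dst.
split=> //; apply/full_chainP; split=> //.
have un : unique_labels F by apply: unique_labels_of_card; rewrite // card.
(* An essential element is neither full nor void, so the counting yields both a bottom and a top. *)
have nofull : ~~ has_full F (ess F).
  apply/exists_inP => -[x /essP[A [B [_ BF _ xB]]] /forall_inP/(_ B BF)].
  by rewrite (negPf xB).
have novoid : ~~ has_void F (ess F).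
  apply/exists_inP => -[x /essP[A [B [AF _ xA _]]] /forall_inP/(_ A AF)].
  by rewrite xA.
apply: (bottom_top_total (subxx _) st un).
  by move: bf; rewrite (negPf nofull) orbF.
by move: tv; rewrite (negPf novoid) orbF.
Qed.

End Starlike.

Theorem theorem4p12 (X : finType) (F : {set {set X}}) (hF : F != set0) :
  ((well_graded F /\ well_graded (dual F)
      <-> full_chain F \/ upward_starlike F \/ downward_starlike F)
   /\ (well_graded F /\ well_graded (dual F) -> additionality F = 1%R))
  /\
  ((well_graded F /\ well_graded (ess_dual F) <-> full_chain F)
   /\ (well_graded F /\ well_graded (ess_dual F) -> additionality F = 1%R)).
Proof.
have classify : well_graded F /\ well_graded (dual F) ->
    #|F| = #|ess F|.+1 /\ (full_chain F \/ upward_starlike F \/ downward_starlike F).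
  by case=> /well_gradedP st /well_graded_dualP; apply: well_graded_dual_classification.
have ess_classify : well_graded F /\ well_graded (ess_dual F) ->
    #|F| = #|ess F|.+1 /\ full_chain F.
  case=> /well_gradedP st /well_graded_ess_dualP.
  exact: well_graded_ess_dual_classification.
split; split.
- split=> [/classify[]//|].
  case=> [/full_chainP[tot st]|[/upward_starlikeP[F0 sF [x0 x0F]]|]].
  + split; first exact/well_gradedP.
    by apply/well_graded_dualP/total_dual_step; rewrite ?subsetT.
  + split; first by case: sF => st _ _ _; apply/well_gradedP.
    exact/well_graded_dualP/(upward_dual_step F0 x0F).
  + case/downward_starlikeP => FT sF [x1 x1F].
    split; first by case: sF => st _ _ _; apply/well_gradedP.
    exact/well_graded_dualP/(downward_dual_step FT x1F).
- by case/classify => /additionality1.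
- split=> [/ess_classify[]//|/full_chainP[tot st]].
  split; first exact/well_gradedP.
  exact/well_graded_ess_dualP/total_dual_step.
- by case/ess_classify => /additionality1.
Qed.
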